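(* Let $\{\mathcal{R}_A\}$ be a zero-divisor functorial family in $\mathbf{CRing}$. Then there exists a functor $\zeta:\mathbf{CRing}\to\mathbf{Graph}$ such that $\zeta(A)$ is the zero-divisor graph $\zeta(A,\mathcal{R}_A)$ for every ring $A$, and $\zeta(f)([a])=[f(a)]$ for every ring homomorphism $f:A\to B$ and every $a\in A$.
   Context: $\mathbf{CRing}$ is the category of commutative unitary rings with homomorphisms preserving $1$. A graph $G=(V(G),E(G))$ is a set $V(G)$ with a symmetric binary relation $E(G)$ on it (loops allowed); a graph morphism $G_1\to G_2$ is a map $V(G_1)\to V(G_2)$ sending adjacent pairs to adjacent pairs; $\mathbf{Graph}$ is the category of graphs and graph morphisms. An equivalence relation $\mathcal{R}$ on a ring $A$ is a zero-divisor relation if, whenever $a\,\mathcal{R}\,a'$ and $b\,\mathcal{R}\,b'$, $ab=0$ implies $a'b'=0$; in this case $\zeta(A,\mathcal{R})$ is the graph with vertex set $A/\mathcal{R}$ in which $[a],[b]$ are adjacent iff $ab=0$. A family $\{\mathcal{R}_A\}$ of equivalence relations, with $\mathcal{R}_A$ an equivalence relation on $A$ for each ring $A$, is functorial if for every ring homomorphism $f:A\to B$ and all $a,a'\in A$, $a\,\mathcal{R}_A\,a'$ implies $f(a)\,\mathcal{R}_B\,f(a')$. A zero-divisor functorial family is a functorial family such that every $\mathcal{R}_A$ is a zero-divisor relation. *)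

(* Defs.v *)
From HB Require Import structures.
From mathcomp Require Import all_boot all_order all_algebra.
From mathcomp Require Import boolp.

Set Implicit Arguments.
Unset Strict Implicit.
Unset Printing Implicit Defensive.

Import GRing.Theory.
Local Open Scope ring_scope.
Local Open Scope quotient_scope.

Record category := Category {
  obj : Type;
  hom : obj -> obj -> Type;
  idm : forall X, hom X X;
  compm : forall X Y Z, hom Y Z -> hom X Y -> hom X Z;
  compm_idl : forall X Y (f : hom X Y), compm (idm Y) f = f;
  compm_idr : forall X Y (f : hom X Y), compm f (idm X) = f;
  compmA : forall X Y Z T (h : hom Z T) (g : hom Y Z) (f : hom X Y),
    compm h (compm g f) = compm (compm h g) f
}.

Record functor (C D : category) := Functor {
  fobj : obj C -> obj D;
  fmap : forall X Y, hom X Y -> hom (fobj X) (fobj Y);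
  fmap_id : forall X, fmap (idm X) = idm (fobj X);
  fmap_comp : forall X Y Z (g : hom Y Z) (f : hom X Y),
    fmap (compm g f) = compm (fmap g) (fmap f)
}.

Lemma rmorphism_ext (A B : comPzRingType) (f g : {rmorphism A -> B}) :
  f =1 g -> f = g.
Proof.
case: f g => [f [[f0] [f1]]] [g [[g0] [g1]]] /= /funext fg.
by subst g; rewrite (Prop_irrelevance f0 g0) (Prop_irrelevance f1 g1).
Qed.

Definition ring_id (A : comPzRingType) : {rmorphism A -> A} := idfun.

Definition ring_comp (A B C : comPzRingType) (g : {rmorphism B -> C})
    (f : {rmorphism A -> B}) : {rmorphism A -> C} := g \o f.

(* comPzRingType, unlike comNzRingType, contains the zero ring. *)
Definition CRing : category :=
  @Category comPzRingType (fun A B => {rmorphism A -> B}) ring_id ring_comp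
    (fun A B f => @rmorphism_ext A B (ring_comp (ring_id B) f) f
                    (fun=> erefl))
    (fun A B f => @rmorphism_ext A B (ring_comp f (ring_id A)) f
                    (fun=> erefl))
    (fun A B C D h g f =>
       @rmorphism_ext A D (ring_comp h (ring_comp g f))
         (ring_comp (ring_comp h g) f) (fun=> erefl)).

Record graph := MkGraph {
  vertex : Type;
  adj : vertex -> vertex -> Prop;
  adj_sym : forall x y, adj x y -> adj y x
}.

Record graph_morphism (G H : graph) := GraphMorphism {
  gfun :> vertex G -> vertex H;
  gfun_adj : forall x y, adj x y -> adj (gfun x) (gfun y)
}.

Lemma graph_morphism_ext (G H : graph) (f g : graph_morphism G H) :
  f =1 g -> f = g.
Proof.
case: f g => [f fP] [g gP] /= /funext fg.
by subst g; rewrite (Prop_irrelevance fP gP).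
Qed.

Definition graph_id (G : graph) : graph_morphism G G :=
  @GraphMorphism G G id (fun _ _ xy => xy).

Definition graph_comp (G H K : graph) (g : graph_morphism H K)
    (f : graph_morphism G H) : graph_morphism G K :=
  @GraphMorphism G K (g \o f) (fun _ _ xy => gfun_adj g (gfun_adj f xy)).

Definition Graph : category :=
  @Category graph graph_morphism graph_id graph_comp
    (fun G H f => @graph_morphism_ext G H (graph_comp (graph_id H) f) f
                    (fun=> erefl))
    (fun G H f => @graph_morphism_ext G H (graph_comp f (graph_id G)) f
                    (fun=> erefl))
    (fun G H K L h g f =>
       @graph_morphism_ext G L (graph_comp h (graph_comp g f))
         (graph_comp (graph_comp h g) f) (fun=> erefl)).

(* Transport of vertices along an equality of graphs. *)
Definition vcast (G H : graph) (e : G = H) (x : vertex G) : vertex H :=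
  ecast K (vertex K) e x.

Definition zd_relation (A : comPzRingType) (R : A -> A -> Prop) : Prop :=
  RelationClasses.Equivalence R /\
  forall a a' b b' : A, R a a' -> R b b' -> a * b = 0 -> a' * b' = 0.

(* MathComp quotients are taken by boolean relations, hence the reflection. *)
Definition brel (T : Type) (R : T -> T -> Prop) : rel T :=
  fun a b => `[< R a b >].

Lemma brel_equiv (T : Type) (R : T -> T -> Prop) :
  RelationClasses.Equivalence R -> equiv_class_of (brel R).
Proof.
case=> R1 Rs Rt; split.
- by move=> a; apply/asboolP.
- by move=> a b; apply/asboolP/asboolP; apply: Rs.
- by move=> b a c /asboolP ab /asboolP bc; apply/asboolP; apply: Rt ab bc.
Qed.

Definition quot (T : choiceType) (R : T -> T -> Prop)
    (eR : RelationClasses.Equivalence R) : Type :=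
  {eq_quot EquivRelPack (brel_equiv eR)}.

Definition qclass (T : choiceType) (R : T -> T -> Prop)
    (eR : RelationClasses.Equivalence R) (a : T) : quot eR :=
  \pi_({eq_quot EquivRelPack (brel_equiv eR)}) a.

Lemma qclass_eq (T : choiceType) (R : T -> T -> Prop)
    (eR : RelationClasses.Equivalence R) (a b : T) :
  qclass eR a = qclass eR b <-> R a b.
Proof.
split=> [/eqmodP/asboolP //|ab].
by apply/eqmodP/asboolP.
Qed.

Definition zd_adj (A : comPzRingType) (R : A -> A -> Prop)
    (zR : zd_relation R) (x y : quot (proj1 zR)) : Prop :=
  exists a b : A,
    [/\ x = qclass (proj1 zR) a, y = qclass (proj1 zR) b & a * b = 0].

Lemma zd_adj_sym (A : comPzRingType) (R : A -> A -> Prop)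
    (zR : zd_relation R) (x y : quot (proj1 zR)) :
  zd_adj x y -> zd_adj y x.
Proof. by case=> a [b [-> -> ab]]; exists b, a; split; rewrite // mulrC. Qed.

Definition zd_graph (A : comPzRingType) (R : A -> A -> Prop)
    (zR : zd_relation R) : graph :=
  MkGraph (@zd_adj_sym A R zR).

Definition zd_class (A : comPzRingType) (R : A -> A -> Prop)
    (zR : zd_relation R) (a : A) : vertex (zd_graph zR) :=
  qclass (proj1 zR) a.

(* The existential in zd_adj does not depend on the representatives. *)
Lemma zd_graph_adjE (A : comPzRingType) (R : A -> A -> Prop)
    (zR : zd_relation R) (a b : A) :
  adj (zd_class zR a) (zd_class zR b) <-> a * b = 0.
Proof.
split=> [[a' [b' [/qclass_eq aa' /qclass_eq bb' ab']]]|ab].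
  have [eR zd] := zR; case: eR => _ Rs _.
  exact: zd (Rs _ _ aa') (Rs _ _ bb') ab'.
by exists a, b.
Qed.

Definition functorial_family (R : forall A : comPzRingType, A -> A -> Prop) :
    Prop :=
  (forall A : comPzRingType, RelationClasses.Equivalence (R A)) /\
  (forall (A B : comPzRingType) (f : {rmorphism A -> B}) (a a' : A),
     R A a a' -> R B (f a) (f a')).

Definition zd_functorial_family
    (R : forall A : comPzRingType, A -> A -> Prop) : Prop :=
  functorial_family R /\ forall A : comPzRingType, zd_relation (R A).

(* Main.v *)
Require Import Defs.
From HB Require Import structures.
From mathcomp Require Import all_boot all_order all_algebra.
From mathcomp Require Import boolp.

(** A ring morphism [f : A -> B] sends [R A]-related elements to [R B]-related
    ones, so [[a] |-> [f a]] is a well-defined map of the quotients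
    ([zd_map_class]).  It preserves adjacency because [a * b = 0] implies
    [f a * f b = f (a * b) = 0] ([zd_map_adj]).  Since classes exhaust the
    vertices ([zd_class_surj]), a graph morphism is determined by its values on
    classes ([zd_graph_morphism_ext]), and there the functor laws reduce to
    those of ring morphisms. *)

Set Implicit Arguments.
Unset Strict Implicit.
Unset Printing Implicit Defensive.

Import GRing.Theory.
Local Open Scope ring_scope.
Local Open Scope quotient_scope.

Definition zd_repr (A : comPzRingType) (R : A -> A -> Prop)
    (zR : zd_relation R) (x : vertex (zd_graph zR)) : A :=
  repr (x : {eq_quot EquivRelPack (brel_equiv (proj1 zR))}).

Lemma zd_reprK (A : comPzRingType) (R : A -> A -> Prop)
    (zR : zd_relation R) : cancel (@zd_repr A R zR) (zd_class zR).
Proof. by move=> x; apply: reprK. Qed.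

Lemma zd_class_surj (A : comPzRingType) (R : A -> A -> Prop)
    (zR : zd_relation R) (x : vertex (zd_graph zR)) :
  exists a, x = zd_class zR a.
Proof. by exists (zd_repr x); rewrite zd_reprK. Qed.

Lemma zd_graph_morphism_ext (A : comPzRingType) (R : A -> A -> Prop)
    (zR : zd_relation R) (G : graph) (g h : graph_morphism (zd_graph zR) G) :
  (forall a, g (zd_class zR a) = h (zd_class zR a)) -> g = h.
Proof.
move=> gh; apply: graph_morphism_ext => x.
by have [a ->] := zd_class_surj x.
Qed.

Section InducedMorphism.

Variables (A B : comPzRingType) (RA : A -> A -> Prop) (RB : B -> B -> Prop).
Variables (zA : zd_relation RA) (zB : zd_relation RB).
Variable f : {rmorphism A -> B}.
Hypothesis fR : forall a a', RA a a' -> RB (f a) (f a').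

Definition zd_map (x : vertex (zd_graph zA)) : vertex (zd_graph zB) :=
  zd_class zB (f (zd_repr x)).

(** The representative chosen for the class of [a] is [RA]-related to [a], and
    [f] turns this into equality of classes. *)
Lemma zd_map_class (a : A) : zd_map (zd_class zA a) = zd_class zB (f a).
Proof.
apply/qclass_eq/fR/(qclass_eq (proj1 zA)).
exact: (zd_reprK (zd_class zA a)).
Qed.

Lemma zd_map_adj (x y : vertex (zd_graph zA)) :
  adj x y -> adj (zd_map x) (zd_map y).
Proof.
case=> a [b [-> -> ab0]].
rewrite !zd_map_class; apply/zd_graph_adjE.
by rewrite -rmorphM ab0 rmorph0.
Qed.

Definition zd_morphism : graph_morphism (zd_graph zA) (zd_graph zB) :=
  GraphMorphism zd_map_adj.

End InducedMorphism.

Theorem proposition3p8 (R : forall A : comPzRingType, A -> A -> Prop)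
    (hR : zd_functorial_family R) :
  exists (zeta : functor CRing Graph)
         (zetaE : forall A : comPzRingType,
            fobj zeta A = zd_graph (proj2 hR A) :> graph),
    forall (A B : comPzRingType) (f : {rmorphism A -> B}) (a : A),
      vcast (zetaE B)
        ((@fmap CRing Graph zeta A B f : graph_morphism _ _)
          (vcast (esym (zetaE A)) (zd_class (proj2 hR A) a)))
      = zd_class (proj2 hR B) (f a).
Proof.
have fR (A B : comPzRingType) (f : {rmorphism A -> B}) := proj2 (proj1 hR) A B f.
pose F (A : comPzRingType) : graph := zd_graph (proj2 hR A).
pose m (A B : comPzRingType) (f : {rmorphism A -> B}) :
  graph_morphism (F A) (F B) := zd_morphism (proj2 hR A) (proj2 hR B) (fR A B f).
have mE A B f a :
    m A B f (zd_class (proj2 hR A) a) = zd_class (proj2 hR B) (f a).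
  exact: zd_map_class (fR A B f) a.
have m1 (A : comPzRingType) : m A A (ring_id A) = graph_id (F A).
  by apply: zd_graph_morphism_ext => a; rewrite mE.
have mM (A B C : comPzRingType) (g : {rmorphism B -> C})
    (f : {rmorphism A -> B}) :
    m A C (ring_comp g f) = graph_comp (m B C g) (m A B f).
  apply: zd_graph_morphism_ext => a; rewrite mE.
  by rewrite -[RHS]/(m B C g (m A B f (zd_class (proj2 hR A) a))) !mE.
(* The object part is [F] on the nose, so the transports are along [erefl]. *)
exists (@Functor CRing Graph F m m1 mM), (fun=> erefl) => A B f a.
exact: mE.
Qed.
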